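(* Let $\pi_1:V_1\to X_1$, $\pi_2:V_2\to X_2$, $\pi_1':V_1'\to X_1$ and $\pi_2':V_2'\to X_2$ be diffeological vector pseudo-bundles. Let $Y\subset X_1$ and let $f:Y\to X_2$ be a smooth injective map. Let $\tilde f:\pi_1^{-1}(Y)\to\pi_2^{-1}(f(Y))$ and $\tilde f':(\pi_1')^{-1}(Y)\to(\pi_2')^{-1}(f(Y))$ be smooth fibrewise linear lifts of $f$, and let $\pi:V_1\cup_{\tilde f}V_2\to X_1\cup_fX_2$ and $\pi':V_1'\cup_{\tilde f'}V_2'\to X_1\cup_fX_2$ be the diffeological vector pseudo-bundles obtained by gluing along $(\tilde f,f)$ and $(\tilde f',f)$ respectively. Let $\tilde f_\times$ be the lift of $f$ defined on the part of $V_1\times_{X_1}V_1'$ lying over $Y$ by $\tilde f_\times(v_1,v_1')=(\tilde f(v_1),\tilde f'(v_1'))\in V_2\times_{X_2}V_2'$. Then the following two pseudo-bundles are diffeomorphic as pseudo-bundles: $$(V_1\cup_{\tilde f}V_2)\times_{X_1\cup_fX_2}(V_1'\cup_{\tilde f'}V_2')\to X_1\cup_fX_2$$ and $$(V_1\times_{X_1}V_1')\cup_{\tilde f_\times}(V_2\times_{X_2}V_2')\to X_1\cup_fX_2,$$ the latter being the gluing of the product pseudo-bundles $V_1\times_{X_1}V_1'\to X_1$ and $V_2\times_{X_2}V_2'\to X_2$ along $(\tilde f_\times,f)$.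
   Context: Diffeological spaces, smooth maps, and the subset, product, sum and quotient diffeologies are the standard ones (plots of a subset: plots of the ambient space with image in it; plots of a product: pairs of plots; plots of a disjoint sum: maps that are locally plots of one summand; plots of a quotient: maps that locally lift to plots). Diffeological vector pseudo-bundle: a smooth map $\pi:V\to X$ of diffeological spaces such that each fibre carries a real vector space structure and the fibrewise addition $V\times_XV\to V$, the scalar multiplication $\mathbb{R}\times V\to V$, and the zero section $X\to V$ are smooth ($V\times_XV\subset V\times V$ with the subset diffeology, $\mathbb{R}$ standard). Gluing: for $Y\subset X_1$ and a smooth $f:Y\to X_2$, $X_1\cup_fX_2$ is the quotient of $X_1\sqcup X_2$ by the relation generated by $y\sim f(y)$, with the quotient of the sum diffeology. A smooth fibrewise linear lift of $f$ is a smooth map $\tilde f:\pi_1^{-1}(Y)\to\pi_2^{-1}(f(Y))$, linear on each fibre, with $\pi_2\circ\tilde f=f\circ\pi_1$ on $\pi_1^{-1}(Y)$. Gluing the pseudo-bundles along $(\tilde f,f)$ gives the induced map $V_1\cup_{\tilde f}V_2\to X_1\cup_fX_2$, with fibres over points of $X_1\setminus Y$ having the vector space structure from $\pi_1$ and all others that from $\pi_2$. Product pseudo-bundle: for pseudo-bundles $V\to X$ and $V'\to X$ over the same base, $V\times_XV'\subset V\times V'$ is the set of pairs with the same image in $X$, with the subset diffeology of the product diffeology, the induced projection to $X$, and componentwise operations on fibres. Two pseudo-bundles are diffeomorphic as pseudo-bundles if there is a diffeomorphism of total spaces, linear on fibres, covering a diffeomorphism of the bases. *)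

(* Defs.v *)
From Stdlib Require Import Relation_Operators.
From mathcomp Require Import all_boot all_order all_algebra.
From mathcomp Require Import boolp classical_sets functions reals topology.
From mathcomp Require Import normedtype landau derive.
Set Implicit Arguments.
Unset Strict Implicit.
Unset Printing Implicit Defensive.
Import Order.TTheory GRing.Theory Num.Theory numFieldNormedType.Exports.
Local Open Scope classical_set_scope.
Local Open Scope ring_scope.

Fixpoint Ck (R : realType) (n : nat) (W : normedModType R) (k : nat)
    (U : set 'rV[R]_n) (f : 'rV[R]_n -> W) : Prop :=
  if k is k'.+1 then
    (forall x, U x -> differentiable f x) /\ (forall v, Ck k' U ('D_v f))
  else forall x, U x -> {for x, continuous f}.

Definition smooth_on (R : realType) (n : nat) (W : normedModType R)
    (U : set 'rV[R]_n) (f : 'rV[R]_n -> W) : Prop := forall k, Ck k U f.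

Section Calculus.
Context {R : realType}.

Lemma near_eq_diff (V W : normedModType R) (f g : V -> W) (x : V) :
  (\near x, f x = g x) -> differentiable f x -> differentiable g x.
Proof.
move=> fg df.
have fgx : f x = g x by exact: nbhs_singleton fg.
have E : g \o shift x = cst (g x) + 'd f x +o_ 0 id.
  apply/eqaddoP => e e0.
  have /eqaddoP /(_ e e0) H := diff_locally df.
  have fg0 : \forall y \near 0, f (y + x) = g (y + x).
    by move: fg; rewrite (near_shift 0 x); apply: filterS => y; rewrite /= subr0.
  by move: fg0 H; apply: filterS2 => y /= fgy; rewrite !fctE /= -fgx -fgy.
have dg : 'd g x = 'd f x :> (V -> W).
  by apply: diff_unique => //; exact: diff_continuous.
apply/diff_locallyP; rewrite dg; split => //; exact: diff_continuous.
Qed.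

Section Ck_theory.
Context {n : nat}.
Implicit Types U : set 'rV[R]_n.

Lemma open_near U (P : 'rV[R]_n -> Prop) x : open U -> U x ->
  (forall y, U y -> P y) -> \near x, P x.
Proof.
move=> oU Ux UP; have := open_nbhs_nbhs (conj oU Ux).
by apply: filterS.
Qed.

Lemma Ck_sub (W : normedModType R) k U U' (f : 'rV[R]_n -> W) :
  U' `<=` U -> Ck k U f -> Ck k U' f.
Proof.
move=> sU; elim: k f => [|k IH] f /=; first by move=> h x /sU; exact: h.
by move=> [h1 h2]; split=> [x /sU/h1 //|v]; exact: IH.
Qed.

Lemma Ck_ext (W : normedModType R) k U (f g : 'rV[R]_n -> W) :
  open U -> (forall x, U x -> f x = g x) -> Ck k U f -> Ck k U g.
Proof.
move=> oU; elim: k f g => [|k IH] f g fg /=.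
  move=> fc x Ux; rewrite /prop_for /continuous_at -(fg _ Ux).
  apply: cvg_trans (fc x Ux); apply: (@near_eq_cvg _ _ (nbhs x)).
  exact: (open_near oU Ux fg).
move=> [fd fD]; split=> [x Ux|v].
  by apply: near_eq_diff (fd x Ux); exact: open_near oU Ux fg.
apply: IH (fD v) => x Ux.
have [->|v0] := eqVneq v 0; first by rewrite !derive0.
by apply: near_eq_derive => //; exact: open_near oU Ux fg.
Qed.

Lemma Ck_continuous (W : normedModType R) k U (f : 'rV[R]_n -> W) :
  Ck k U f -> forall x, U x -> {for x, continuous f}.
Proof.
case: k => [//|k] [fd _] x Ux; apply: differentiable_continuous; exact: fd.
Qed.

Lemma CkS (W : normedModType R) k U (f : 'rV[R]_n -> W) :
  Ck k.+1 U f -> Ck k U f.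
Proof.
elim: k f => [|k IH] f; first exact: Ck_continuous.
by move=> [fd fD]; split=> // v; apply: IH; exact: fD.
Qed.

Lemma Ck_local (W : normedModType R) k U (f : 'rV[R]_n -> W) :
  (forall x, U x -> exists U', U' x /\ Ck k U' f) -> Ck k U f.
Proof.
elim: k f => [|k IH] f H /=.
  by move=> x /H [U' [U'x h]]; exact: h.
split=> [x /H[U' [U'x [h _]]]|v]; first exact: h.
by apply: IH => x /H[U' [U'x [_ fD]]]; exists U'; split=> //; exact: fD.
Qed.

Lemma Ck_cst (W : normedModType R) k U (c : W) : Ck k U (cst c : 'rV[R]_n -> W).
Proof.
elim: k c => [|k IH] c /=; first by move=> x _; exact: cst_continuous.
split=> [x _|v]; first exact: differentiable_cst.
rewrite (_ : 'D_v _ = cst 0) //.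
by apply/funext => x; exact: derive_cst.
Qed.

Lemma CkD (W : normedModType R) k U (f g : 'rV[R]_n -> W) : open U ->
  Ck k U f -> Ck k U g -> Ck k U (fun x => f x + g x).
Proof.
move=> oU; elim: k f g => [|k IH] f g /=.
  by move=> fc gc x Ux; apply: continuousD; [exact: fc|exact: gc].
move=> [fd fD] [gd gD]; split=> [x Ux|v].
  by apply: differentiableD; [exact: fd|exact: gd].
apply: Ck_ext (IH _ _ (fD v) (gD v)) => // x Ux.
by rewrite deriveD //; apply: diff_derivable; [exact: fd|exact: gd].
Qed.

Lemma CkM k U (f g : 'rV[R]_n -> R) : open U ->
  Ck k U f -> Ck k U g -> Ck k U (fun x => f x * g x).
Proof.
move=> oU; elim: k f g => [|k IH] f g.
  by move=> fc gc x Ux; apply: continuousM; [exact: fc|exact: gc].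
move=> Cf Cg; have := CkS Cf; have := CkS Cg.
case: Cf Cg => [fd fD] [gd gD] gk fk; split=> [x Ux|v].
  by apply: differentiableM; [exact: fd|exact: gd].
apply: Ck_ext (CkD oU (IH _ _ fk (gD v)) (IH _ _ gk (fD v))) => // x Ux.
by rewrite deriveM //; apply: diff_derivable; [exact: fd|exact: gd].
Qed.

Lemma Ck_sum k U m (f : 'I_m -> 'rV[R]_n -> R) : open U ->
  (forall i, Ck k U (f i)) -> Ck k U (fun x => \sum_(i < m) f i x).
Proof.
move=> oU; elim: m f => [|m IH] f Cf.
  by apply: Ck_ext (Ck_cst k U (0 : R)) => // x _; rewrite big_ord0.
apply: Ck_ext (CkD oU (IH (fun i => f (widen_ord (leqnSn m) i)) _) (Cf ord_max)) => //.
by move=> x _; rewrite big_ord_recr.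
Qed.

Lemma Ck_coord k U m (f : 'rV[R]_n -> 'rV[R]_m) i : open U ->
  Ck k U f -> Ck k U (fun x => f x 0 i : R).
Proof.
move=> oU; elim: k f => [|k IH] f.
  move=> fc x Ux; apply: (@continuous_comp _ _ _ f (fun M : 'rV[R]_m => M 0 i)).
    exact: fc.
  exact: coord_continuous.
move=> [fd fD]; split=> [x Ux|v].
  apply: (@differentiable_comp _ _ _ _ f (fun M : 'rV[R]_m => M 0 i)).
    exact: fd.
  exact: differentiable_coord.
apply: Ck_ext (IH _ (fD v)) => // x Ux.
by rewrite derive_mx ?mxE //; apply: diff_derivable; exact: fd.
Qed.

End Ck_theory.

Lemma Ck_comp k n m (U : set 'rV[R]_n) (U' : set 'rV[R]_m)
    (f : 'rV[R]_n -> R) (h : 'rV[R]_m -> 'rV[R]_n) :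
  open U' -> (forall x, U' x -> U (h x)) -> Ck k U f -> Ck k U' h ->
  Ck k U' (f \o h).
Proof.
move=> oU' hU; elim: k f => [|k IH] f.
  move=> fc hc x Ux; apply: continuous_comp; first exact: hc.
  by apply: fc; exact: hU.
move=> [fd fD] Ch; have hk := CkS Ch; case: Ch => [hd hD].
have fhd x : U' x -> differentiable (f \o h) x.
  by move=> Ux; apply: differentiable_comp; [exact: hd|apply: fd; exact: hU].
split=> [//|v].
have H : Ck k U' (fun x => \sum_(i < n) ('D_v h x) 0 i * 'D_(delta_mx 0 i) f (h x)).
  apply: Ck_sum => // i; apply: CkM => //.
    by apply: Ck_coord => //; exact: hD.
  by apply: (IH _ (fD (delta_mx 0 i)) hk).
apply: Ck_ext H => // x Ux.
rewrite [RHS]deriveE; last exact: fhd.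
rewrite diff_comp; [|exact: hd|exact/fd/hU].
rewrite /= -(deriveE _ (hd _ Ux)) [in RHS](row_sum_delta ('D_v h x)) linear_sum.
by apply: eq_bigr => i _; rewrite linearZ /= [in LHS](deriveE _ (fd _ (hU _ Ux))).
Qed.
End Calculus.

Lemma smooth_preimage_open (R : realType) (m n : nat) (U : set 'rV[R]_m)
    (W : set 'rV[R]_n) (h : 'rV[R]_m -> 'rV[R]_n) :
  open U -> open W -> smooth_on U h -> open (U `&` h @^-1` W).
Proof.
move=> oU oW /(_ 0) hc; rewrite openE => x [Ux Wx]; rewrite /interior.
apply: filterI; first exact: open_nbhs_nbhs.
by apply: (hc x Ux); exact: open_nbhs_nbhs.
Qed.

Definition lifts_near (R : realType) (T S : Type) (n : nat)
    (plotT : set 'rV[R]_n -> ('rV[R]_n -> T) -> Prop) (pi : T -> S)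
    (U : set 'rV[R]_n) (p : 'rV[R]_n -> S) (x : 'rV[R]_n) : Prop :=
  exists (W : set 'rV[R]_n) (q : 'rV[R]_n -> T),
    [/\ W x, W `<=` U, plotT W q & forall y, W y -> p y = pi (q y)].

(* A plot is a map defined on an open subset U of R^n; it is encoded as a total
   function on 'rV[R]_n together with U, and plot_local (with W = U) makes
   being a plot depend on the values on U only. *)
Record diffeoSpace (R : realType) := DiffeoSpace {
  dsort :> Type;
  plot : forall n : nat, set 'rV[R]_n -> ('rV[R]_n -> dsort) -> Prop;
  plot_open : forall n (U : set 'rV[R]_n) p, plot U p -> open U;
  plot_cst : forall n (U : set 'rV[R]_n) x, open U -> plot U (fun=> x);
  plot_local : forall n (U : set 'rV[R]_n) p, open U ->
    (forall x, U x -> lifts_near (@plot n) id U p x) -> plot U p;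
  plot_comp : forall m n (U : set 'rV[R]_m) (W : set 'rV[R]_n) p
      (h : 'rV[R]_m -> 'rV[R]_n),
    plot W p -> open U -> smooth_on U h -> (forall x, U x -> W (h x)) ->
    plot U (p \o h)
}.

Definition smooth (R : realType) (X Y : diffeoSpace R) (f : X -> Y) : Prop :=
  forall n (U : set 'rV[R]_n) p, plot U p -> plot U (f \o p).

Definition diffeomorphism (R : realType) (X Y : diffeoSpace R) (f : X -> Y) :
    Prop :=
  smooth f /\ exists g : Y -> X, [/\ smooth g, cancel f g & cancel g f].

Section PlotTheory.
Context {R : realType}.
Implicit Types X : diffeoSpace R.

Lemma plot_ext X n (U : set 'rV[R]_n) (p q : 'rV[R]_n -> X) :
  plot U q -> (forall x, U x -> p x = q x) -> plot U p.
Proof.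
move=> pq pE; apply: plot_local => [|x Ux]; first exact: plot_open pq.
by exists U, q; split.
Qed.

Lemma smooth_on_id n (U : set 'rV[R]_n) : smooth_on U (@idfun 'rV[R]_n).
Proof.
case=> [|k]; first by move=> x _ A.
split=> [x _|v]; first exact: ex_diff.
rewrite (_ : 'D_v _ = cst v); first exact: Ck_cst.
by apply/funext => x; rewrite derive_id.
Qed.

Lemma plot_sub X n (U W : set 'rV[R]_n) (p : 'rV[R]_n -> X) :
  open W -> W `<=` U -> plot U p -> plot W p.
Proof.
by move=> oW WU pp; apply: (plot_comp (h := idfun) pp oW) => //; exact: smooth_on_id.
Qed.

Lemma lifts_near_comp X (S : Type) (pi : X -> S) m n (U : set 'rV[R]_m)
    (W : set 'rV[R]_n) p (h : 'rV[R]_m -> 'rV[R]_n) x :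
  lifts_near (@plot R X n) pi W p (h x) -> open U -> smooth_on U h -> U x ->
  lifts_near (@plot R X m) pi U (p \o h) x.
Proof.
move=> [W' [q [W'x W'W pq pE]]] oU sh Ux.
have oUW := smooth_preimage_open oU (plot_open pq) sh.
exists (U `&` h @^-1` W'), (q \o h); split=> //.
- apply: (plot_comp pq) => // [k|y []//].
  by apply: Ck_sub (sh k) => y [].
- by move=> y [_ /pE].
Qed.

Lemma lifts_near_sub X (S : Type) (pi : X -> S) n (U W : set 'rV[R]_n) p q x :
  W `<=` U -> (forall y, W y -> p y = q y) ->
  lifts_near (@plot R X n) pi W q x -> lifts_near (@plot R X n) pi U p x.
Proof.
move=> WU pq [W' [q' [W'x W'W pq' qE]]]; exists W', q'; split=> //.
  by move=> y /W'W/WU.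
by move=> y W'y; rewrite pq ?qE //; exact: W'W.
Qed.

Lemma lifts_near_cst X (S : Type) (pi : X -> S) n (U : set 'rV[R]_n) a x :
  open U -> U x -> lifts_near (@plot R X n) pi U (fun=> pi a) x.
Proof.
move=> oU Ux; exists U, (fun=> a); split=> //; exact: plot_cst.
Qed.

End PlotTheory.

(* The standard diffeology of the real line. *)
Section RealLine.
Variable R : realType.

Definition real_plot n (U : set 'rV[R]_n) (p : 'rV[R]_n -> R) : Prop :=
  open U /\ smooth_on U p.

Fact real_plot_open n (U : set 'rV[R]_n) p : real_plot U p -> open U.
Proof. by case. Qed.

Fact real_plot_cst n (U : set 'rV[R]_n) x : open U -> real_plot U (fun=> x).
Proof. by move=> oU; split=> // k; exact: Ck_cst. Qed.

Fact real_plot_local n (U : set 'rV[R]_n) p : open U ->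
  (forall x, U x -> lifts_near (@real_plot n) id U p x) -> real_plot U p.
Proof.
move=> oU H; split=> // k; apply: Ck_local => x /H[W [q [Wx WU [oW sq] pE]]].
by exists W; split=> //; apply: Ck_ext (sq k) => // y /pE.
Qed.

Fact real_plot_comp m n (U : set 'rV[R]_m) (W : set 'rV[R]_n) p
    (h : 'rV[R]_m -> 'rV[R]_n) :
  real_plot W p -> open U -> smooth_on U h -> (forall x, U x -> W (h x)) ->
  real_plot U (p \o h).
Proof.
by move=> [oW sp] oU sh hU; split=> // k; apply: Ck_comp hU (sp k) (sh k).
Qed.

Definition realD := DiffeoSpace real_plot_open real_plot_cst real_plot_local
  real_plot_comp.
End RealLine.

Section Subset.
Context {R : realType} {X : diffeoSpace R} (A : set X).

Definition sub_plot n (U : set 'rV[R]_n) (p : 'rV[R]_n -> A) : Prop :=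
  plot U (val \o p).

Fact sub_plot_open n (U : set 'rV[R]_n) p : sub_plot U p -> open U.
Proof. exact: plot_open. Qed.

Fact sub_plot_cst n (U : set 'rV[R]_n) x : open U -> sub_plot U (fun=> x).
Proof. exact: plot_cst. Qed.

Fact sub_plot_local n (U : set 'rV[R]_n) p : open U ->
  (forall x, U x -> lifts_near (@sub_plot n) id U p x) -> sub_plot U p.
Proof.
move=> oU H; apply: plot_local => // x /H[W [q [Wx WU pq pE]]].
by exists W, (val \o q); split=> // y /pE /= ->.
Qed.

Fact sub_plot_comp m n (U : set 'rV[R]_m) (W : set 'rV[R]_n) p
    (h : 'rV[R]_m -> 'rV[R]_n) :
  sub_plot W p -> open U -> smooth_on U h -> (forall x, U x -> W (h x)) ->
  sub_plot U (p \o h).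
Proof. by move=> pp oU sh hU; exact: (plot_comp pp). Qed.

Definition subD := DiffeoSpace sub_plot_open sub_plot_cst sub_plot_local
  sub_plot_comp.
End Subset.

Section Product.
Context {R : realType} (X Y : diffeoSpace R).

Definition prod_plot n (U : set 'rV[R]_n) (p : 'rV[R]_n -> X * Y) : Prop :=
  plot U (fst \o p) /\ plot U (snd \o p).

Fact prod_plot_open n (U : set 'rV[R]_n) p : prod_plot U p -> open U.
Proof. by case=> /plot_open. Qed.

Fact prod_plot_cst n (U : set 'rV[R]_n) x : open U -> prod_plot U (fun=> x).
Proof. by move=> oU; split; exact: plot_cst. Qed.

Fact prod_plot_local n (U : set 'rV[R]_n) p : open U ->
  (forall x, U x -> lifts_near (@prod_plot n) id U p x) -> prod_plot U p.
Proof.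
move=> oU H; split; apply: plot_local => // x /H[W [q [Wx WU [pq1 pq2] pE]]].
  by exists W, (fst \o q); split=> // y /pE /= ->.
by exists W, (snd \o q); split=> // y /pE /= ->.
Qed.

Fact prod_plot_comp m n (U : set 'rV[R]_m) (W : set 'rV[R]_n) p
    (h : 'rV[R]_m -> 'rV[R]_n) :
  prod_plot W p -> open U -> smooth_on U h -> (forall x, U x -> W (h x)) ->
  prod_plot U (p \o h).
Proof.
by move=> [pp1 pp2] oU sh hU; split; [exact: (plot_comp pp1)|exact: (plot_comp pp2)].
Qed.

Definition prodD := DiffeoSpace prod_plot_open prod_plot_cst prod_plot_local
  prod_plot_comp.
End Product.

Section Sum.
Context {R : realType} (X Y : diffeoSpace R).

Definition sum_plot n (U : set 'rV[R]_n) (p : 'rV[R]_n -> X + Y) : Prop :=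
  open U /\ forall x, U x ->
    lifts_near (@plot R X n) inl U p x \/ lifts_near (@plot R Y n) inr U p x.

Fact sum_plot_open n (U : set 'rV[R]_n) p : sum_plot U p -> open U.
Proof. by case. Qed.

Fact sum_plot_cst n (U : set 'rV[R]_n) x : open U -> sum_plot U (fun=> x).
Proof.
move=> oU; split=> // y Uy.
by case: x => x; [left|right]; exact: lifts_near_cst.
Qed.

Fact sum_plot_local n (U : set 'rV[R]_n) p : open U ->
  (forall x, U x -> lifts_near (@sum_plot n) id U p x) -> sum_plot U p.
Proof.
move=> oU H; split=> // x /H[W [q [Wx WU [oW /(_ x Wx) qx] pE]]].
by case: qx => qx; [left|right]; exact: lifts_near_sub qx.
Qed.

Fact sum_plot_comp m n (U : set 'rV[R]_m) (W : set 'rV[R]_n) p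
    (h : 'rV[R]_m -> 'rV[R]_n) :
  sum_plot W p -> open U -> smooth_on U h -> (forall x, U x -> W (h x)) ->
  sum_plot U (p \o h).
Proof.
move=> [oW pp] oU sh hU; split=> // x Ux.
by case: (pp _ (hU _ Ux)) => px; [left|right]; apply: (lifts_near_comp px).
Qed.

Definition sumD := DiffeoSpace sum_plot_open sum_plot_cst sum_plot_local
  sum_plot_comp.
End Sum.

Section Quotient.
Context {R : realType} {X : diffeoSpace R} (r : X -> X -> Prop).

(* The quotient of X by the equivalence relation generated by r, as the type of
   equivalence classes. *)
Definition quot : Type := range (clos_refl_sym_trans X r : X -> set X).

Definition class (x : X) : quot :=
  SigSub (mem_set (imageT (clos_refl_sym_trans X r : X -> set X) x)).

Lemma class_surj (q : quot) : exists x, class x = q.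
Proof.
have [x _ xq] := set_valP q; exists x; exact: val_inj.
Qed.

Lemma class_eq x y : clos_refl_sym_trans X r x y -> class x = class y.
Proof.
move=> xy; apply: val_inj => /=; apply/seteqP; split=> z.
  by apply: rst_trans; exact: rst_sym.
exact: rst_trans.
Qed.

Lemma class_eqP x y : class x = class y -> clos_refl_sym_trans X r x y.
Proof.
by move=> /(congr1 val) /= /(congr1 (fun A => A y)) ->; exact: rst_refl.
Qed.

Definition quot_plot n (U : set 'rV[R]_n) (p : 'rV[R]_n -> quot) : Prop :=
  open U /\ forall x, U x -> lifts_near (@plot R X n) class U p x.

Fact quot_plot_open n (U : set 'rV[R]_n) p : quot_plot U p -> open U.
Proof. by case. Qed.

Fact quot_plot_cst n (U : set 'rV[R]_n) x : open U -> quot_plot U (fun=> x).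
Proof.
have [y <-] := class_surj x.
by move=> oU; split=> // z Uz; exact: lifts_near_cst.
Qed.

Fact quot_plot_local n (U : set 'rV[R]_n) p : open U ->
  (forall x, U x -> lifts_near (@quot_plot n) id U p x) -> quot_plot U p.
Proof.
move=> oU H; split=> // x /H[W [q [Wx WU [oW /(_ x Wx) qx] pE]]].
exact: lifts_near_sub qx.
Qed.

Fact quot_plot_comp m n (U : set 'rV[R]_m) (W : set 'rV[R]_n) p
    (h : 'rV[R]_m -> 'rV[R]_n) :
  quot_plot W p -> open U -> smooth_on U h -> (forall x, U x -> W (h x)) ->
  quot_plot U (p \o h).
Proof.
move=> [oW pp] oU sh hU; split=> // x Ux.
exact: lifts_near_comp (pp _ (hU _ Ux)) _ _ _.
Qed.

Definition quotD := DiffeoSpace quot_plot_open quot_plot_cst quot_plot_local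
  quot_plot_comp.
End Quotient.

(* A family of real vector spaces over X: a space famT, a map proj to X, and on
   each fibre proj @^-1` [set x] the vector space structure transported from
   fib x along the bijection vec x, whose inverse is the restriction of coord x
   (the values of coord x outside the fibre over x are irrelevant). *)
Record linFamily (R : realType) (X : diffeoSpace R) := LinFamily {
  famT :> diffeoSpace R;
  proj : famT -> X;
  fib : X -> lmodType R;
  vec : forall x, fib x -> famT;
  coord : forall x, famT -> fib x;
  proj_vec : forall x a, proj (@vec x a) = x;
  vecK : forall x, cancel (@vec x) (coord x);
  coordK : forall v, vec (coord (proj v) v) = v
}.

Section FamilyOperations.
Context {R : realType} {X : diffeoSpace R}.

Definition fadd (V : linFamily X) (v w : V) : V :=
  vec (coord (proj v) v + coord (proj v) w).

Definition fscale (V : linFamily X) (a : R) (v : V) : V :=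
  vec (a *: coord (proj v) v).

Definition fzero (V : linFamily X) (x : X) : V := vec (0 : fib V x).

Definition fprod (V V' : linFamily X) : set (prodD V V') :=
  [set p | proj p.1 = proj p.2].

End FamilyOperations.
Arguments fzero {R X} V x.
Arguments fprod {R X} V V' _.

Record pseudoBundle (R : realType) (X : diffeoSpace R) := PseudoBundle {
  family :> linFamily X;
  proj_smooth : smooth (@proj R X family);
  fadd_smooth :
    smooth (fun p : subD (fprod family family) => fadd (val p).1 (val p).2);
  fscale_smooth :
    smooth (fun p : prodD (realD R) family => fscale p.1 p.2);
  fzero_smooth : smooth (fzero family)
}.

Definition bundle_diffeomorphic (R : realType) (X X' : diffeoSpace R)
    (V : pseudoBundle X) (V' : pseudoBundle X') : Prop :=
  exists (phi : V -> V') (g : X -> X'),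
    [/\ diffeomorphism phi, diffeomorphism g,
        forall v, proj (phi v) = g (proj v) &
        forall x, linear (fun a : fib V x => coord (g x) (phi (vec a)))].

Section Auxiliary.
Context {R : realType}.

Lemma linear_add (U V : lmodType R) (g : U -> V) : linear g ->
  forall a b, g (a + b) = g a + g b.
Proof. by move=> gl a b; rewrite -[a in LHS]scale1r gl scale1r. Qed.

Lemma linear_zero (U V : lmodType R) (g : U -> V) : linear g -> g 0 = 0.
Proof.
by move=> gl; have := gl (-1) 0 0; rewrite scaler0 addr0 scaleN1r addNr.
Qed.

Lemma linear_scale (U V : lmodType R) (g : U -> V) : linear g ->
  forall c a, g (c *: a) = c *: g a.
Proof.
by move=> gl c a; rewrite -[c *: a in LHS]addr0 gl (linear_zero gl) addr0.
Qed.

Lemma plot_subE (X : diffeoSpace R) (A : set X) n (U : set 'rV[R]_n)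
    (q : 'rV[R]_n -> X) x :
  plot U q -> U x -> (forall y, U y -> A (q y)) ->
  exists2 p : 'rV[R]_n -> subD A, plot U p & forall y, U y -> val (p y) = q y.
Proof.
move=> pq Ux qA; pose x0 : subD A := SigSub (mem_set (qA x Ux)).
pose p y : subD A := insubd x0 (q y).
have pE y : U y -> val (p y) = q y.
  by move=> /qA Aq; rewrite val_insubd mem_set.
by exists p => //; exact: (plot_ext pq).
Qed.

Lemma fadd_plot (X : diffeoSpace R) (V : pseudoBundle X) n (U : set 'rV[R]_n)
    (q1 q2 : 'rV[R]_n -> V) :
  plot U q1 -> plot U q2 -> (forall y, U y -> proj (q1 y) = proj (q2 y)) ->
  plot U (fun y => fadd (q1 y) (q2 y)).
Proof.
move=> pq1 pq2 q12; apply: plot_local => [|x Ux]; first exact: plot_open pq1.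
pose q y : prodD V V := (q1 y, q2 y).
have pq : plot U q by split.
have [p pp pE] := plot_subE (A := fprod V V) pq Ux q12.
exists U, (fun y => fadd (val (p y)).1 (val (p y)).2); split=> //.
  exact: (fadd_smooth pp).
by move=> y /pE ->.
Qed.
End Auxiliary.

Section ProductBundle.
Context {R : realType} {X : diffeoSpace R}.

Section Family.
Variables V V' : linFamily X.

Definition prod_proj (p : subD (fprod V V')) : X := proj (val p).1.

Definition prod_fib (x : X) : lmodType R := (fib V x * fib V' x)%type.

Fact prod_vec_subproof x (a : prod_fib x) : fprod V V' (vec a.1, vec a.2).
Proof. by rewrite /fprod /= !proj_vec. Qed.

Definition prod_vec x (a : prod_fib x) : subD (fprod V V') :=
  SigSub (mem_set (prod_vec_subproof a)).

Definition prod_coord x (p : subD (fprod V V')) : prod_fib x :=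
  (coord x (val p).1, coord x (val p).2).

Fact prod_proj_vec x a : prod_proj (@prod_vec x a) = x.
Proof. exact: proj_vec. Qed.

Fact prod_vecK x : cancel (@prod_vec x) (@prod_coord x).
Proof. by case=> a b; rewrite /prod_coord /= !vecK. Qed.

Fact prod_coordK p : prod_vec (prod_coord (prod_proj p) p) = p.
Proof.
apply: val_inj; rewrite /prod_proj /=; case: p => -[v w] vw /=.
have vw' : proj v = proj w := set_mem vw.
by rewrite coordK vw' coordK.
Qed.

Definition prod_family : linFamily X :=
  LinFamily prod_proj_vec prod_vecK prod_coordK.
End Family.

Variables V V' : pseudoBundle X.
Let W := prod_family V V'.

Fact prod_proj_smooth : smooth (@proj R X W).
Proof. by move=> n U p [p1 _]; exact: (proj_smooth p1). Qed.

Fact prod_fadd_smooth :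
  smooth (fun p : subD (fprod W W) => fadd (val p).1 (val p).2).
Proof.
move=> n U p [[p11 p12] [p21 p22]]; split.
  have H y : fprod V V ((val (val (p y)).1).1, (val (val (p y)).2).1).
    exact: (set_valP (p y)).
  pose q y : subD (fprod V V) := SigSub (mem_set (H y)).
  exact: (@fadd_smooth _ _ V n U q (conj p11 p21)).
have H y : fprod V' V' ((val (val (p y)).1).2, (val (val (p y)).2).2).
  rewrite /fprod /=; have /= <- := set_valP (val (p y)).1; have /= <- := set_valP (val (p y)).2.
  exact: (set_valP (p y)).
pose q y : subD (fprod V' V') := SigSub (mem_set (H y)).
have := @fadd_smooth _ _ V' n U q (conj p12 p22).
move=> H0; apply: (plot_ext H0) => x Ux /=; rewrite /fadd /= /prod_proj.
by have /= -> := set_valP (val (p x)).1.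
Qed.

Fact prod_fscale_smooth :
  smooth (fun p : prodD (realD R) W => fscale p.1 p.2).
Proof.
move=> n U p [p0 [p1 p2]]; split.
  exact: (@fscale_smooth _ _ V n U (fun y => ((p y).1, (val (p y).2).1))
            (conj p0 p1)).
have := @fscale_smooth _ _ V' n U (fun y => ((p y).1, (val (p y).2).2))
            (conj p0 p2).
move=> H0; apply: (plot_ext H0) => x Ux /=; rewrite /fscale /= /prod_proj.
by have /= -> := set_valP (p x).2.
Qed.

Fact prod_fzero_smooth : smooth (fzero W).
Proof.
by move=> n U p pp; split; [exact: (fzero_smooth V pp)|exact: (fzero_smooth V' pp)].
Qed.

Definition prod_bundle : pseudoBundle X :=
  PseudoBundle prod_proj_smooth prod_fadd_smooth prod_fscale_smooth
    prod_fzero_smooth.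
End ProductBundle.

Section Gluing.
Context {R : realType} {X1 X2 : diffeoSpace R} {Y : set X1}.
Variable f : subD Y -> X2.

Definition glue_rel (s t : sumD X1 X2) : Prop :=
  exists y : subD Y, s = inl (val y) /\ t = inr (f y).

Definition glueD : diffeoSpace R := quotD glue_rel.

Definition inlG (x : X1) : glueD := class glue_rel (inl x).
Definition inrG (x : X2) : glueD := class glue_rel (inr x).

(* Every class of glueD has exactly one representative in (X1 \ Y) + X2;
   glue_nf s is the one equivalent to s. *)
Definition glue_nf (s : X1 + X2) : X1 + X2 :=
  match s with
  | inl x => if insub x is Some y then inr (f y) else inl x
  | inr x => inr x
  end.

Definition glue_rep (q : glueD) : X1 + X2 :=
  glue_nf (projT1 (cid (class_surj q))).

Lemma inlG_glue (y : subD Y) : inlG (val y) = inrG (f y).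
Proof. by apply: class_eq; apply: rst_step; exists y. Qed.

Lemma glue_nf_in (y : subD Y) : glue_nf (inl (val y)) = inr (f y).
Proof. by rewrite /glue_nf valK. Qed.

Lemma glue_nf_notin x : ~ Y x -> glue_nf (inl x) = inl x.
Proof. by move=> Yx; rewrite /glue_nf insubF //; exact: memNset. Qed.

Lemma class_glue_nf s : class glue_rel (glue_nf s) = class glue_rel s.
Proof.
case: s => // x; have [Yx|Yx] := pselect (Y x); last by rewrite glue_nf_notin.
pose y : subD Y := SigSub (mem_set Yx).
rewrite (_ : x = val y) // glue_nf_in; exact/esym/inlG_glue.
Qed.

Lemma glue_nf_eq s t : clos_refl_sym_trans _ glue_rel s t ->
  glue_nf s = glue_nf t.
Proof.
elim=> [{}s {}t [y [-> ->]]|//|//|? ? ? _ -> _ -> //].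
exact: glue_nf_in.
Qed.

Lemma glue_nf_idem s : glue_nf (glue_nf s) = glue_nf s.
Proof. by apply: glue_nf_eq; apply: class_eqP; exact: class_glue_nf. Qed.

Lemma glue_rep_class s : glue_rep (class glue_rel s) = glue_nf s.
Proof.
rewrite /glue_rep; case: cid => t /= ts; apply: glue_nf_eq; exact: class_eqP.
Qed.

Lemma class_glue_rep q : class glue_rel (glue_rep q) = q.
Proof.
by have [s <-] := class_surj q; rewrite glue_rep_class class_glue_nf.
Qed.

Lemma glue_nf_rep q : glue_nf (glue_rep q) = glue_rep q.
Proof. exact: glue_nf_idem. Qed.

Lemma inrG_inj : injective inrG.
Proof.
move=> x x' /(congr1 glue_rep).
by rewrite /inrG !glue_rep_class /= => -[].
Qed.

Lemma inlG_inrG x x' : inlG x = inrG x' ->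
  exists2 y : subD Y, x = val y & f y = x'.
Proof.
move=> /(congr1 glue_rep); rewrite /inlG /inrG !glue_rep_class.
have [Yx|Yx] := pselect (Y x); last by rewrite glue_nf_notin.
pose y : subD Y := SigSub (mem_set Yx).
by rewrite (_ : x = val y) // glue_nf_in /= => -[<-]; exists y.
Qed.

Lemma inlG_inj : injective f -> injective inlG.
Proof.
move=> f_inj x x' xx'.
have [Yx|Yx] := pselect (Y x); have [Yx'|Yx'] := pselect (Y x').
- pose y : subD Y := SigSub (mem_set Yx).
  pose y' : subD Y := SigSub (mem_set Yx').
  move: xx'; rewrite (_ : x = val y) // (_ : x' = val y') // !inlG_glue.
  by move/inrG_inj/f_inj => ->.
- pose y : subD Y := SigSub (mem_set Yx).
  move: xx'; rewrite (_ : x = val y) // inlG_glue => /esym/inlG_inrG[z x'z _].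
  by case: Yx'; rewrite x'z; exact: set_valP.
- pose y : subD Y := SigSub (mem_set Yx').
  move: xx'; rewrite (_ : x' = val y) // inlG_glue => /inlG_inrG[z xz _].
  by case: Yx; rewrite xz; exact: set_valP.
- move/(congr1 glue_rep): xx'.
  by rewrite /inlG !glue_rep_class !glue_nf_notin // => -[].
Qed.

Lemma glueP (q : glueD) :
  (exists x, q = inlG x) \/ (exists x, q = inrG x).
Proof.
by have [[x|x] <-] := class_surj q; [left|right]; exists x.
Qed.

Lemma glue_plotP n (U : set 'rV[R]_n) (p : 'rV[R]_n -> glueD) x :
  plot U p -> U x ->
  lifts_near (@plot R X1 n) inlG U p x \/ lifts_near (@plot R X2 n) inrG U p x.
Proof.
move=> [oU pp] /pp[W [q [Wx WU [oW /(_ x Wx) qq] pE]]].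
by case: qq => -[W' [q' [W'x W'W pq' q'E]]]; [left|right];
  (exists W', q'; split=> // [y /W'W/WU //|y W'y]; rewrite pE ?q'E //; exact: W'W).
Qed.

Lemma inlG_smooth : smooth inlG.
Proof.
move=> n U p pp; have oU := plot_open pp; split=> // x Ux.
exists U, (inl \o p); split=> //; split=> // y Uy; left.
by exists U, p; split.
Qed.

Lemma inrG_smooth : smooth inrG.
Proof.
move=> n U p pp; have oU := plot_open pp; split=> // x Ux.
exists U, (inr \o p); split=> //; split=> // y Uy; right.
by exists U, p; split.
Qed.

Lemma glue_smooth (Z : diffeoSpace R) (g : glueD -> Z) :
  smooth (g \o inlG) -> smooth (g \o inrG) -> smooth g.
Proof.
move=> g1 g2 n U p pp; apply: plot_local => [|x Ux]; first exact: plot_open pp.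
have [|] := glue_plotP pp Ux => -[W [q [Wx WU pq pE]]].
  exists W, (g \o inlG \o q); split=> //; first exact: g1.
  by move=> y /pE /= ->.
exists W, (g \o inrG \o q); split=> //; first exact: g2.
by move=> y /pE /= ->.
Qed.

End Gluing.

Section Lift.
Context {R : realType} {X1 X2 : diffeoSpace R} {Y : set X1}.

Definition over (V : linFamily X1) : set V := @proj R X1 V @^-1` Y.
Arguments over V _ : clear implicits.

Definition over_base (V : linFamily X1) (v : subD (over V)) : subD Y :=
  SigSub (mem_set (set_valP v : Y (proj (val v)))).

Fact over_vec_subproof (V : linFamily X1) (y : subD Y) (a : fib V (val y)) :
  over V (vec a).
Proof. by rewrite /over /= proj_vec; exact: set_valP. Qed.

Definition over_vec (V : linFamily X1) (y : subD Y) (a : fib V (val y)) :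
  subD (over V) := SigSub (mem_set (over_vec_subproof a)).

Record fibrewiseLift (f : subD Y -> X2) (V1 : linFamily X1)
    (V2 : linFamily X2) := FibrewiseLift {
  lfun :> subD (over V1) -> subD (@proj R X2 V2 @^-1` range f);
  lfun_smooth : smooth lfun;
  lfun_proj : forall v, proj (val (lfun v)) = f (over_base v);
  lfun_linear : forall y : subD Y, linear (fun a : fib V1 (val y) =>
    coord (f y) (val (lfun (over_vec a))) : fib V2 (f y))
}.

End Lift.
Arguments over {R X1} Y V _.
Arguments lfun_linear {R X1 X2 Y f V1 V2} _ y _ _ _.

Section GlueFamily.
Context {R : realType} {X1 X2 : diffeoSpace R} {Y : set X1}.
Context {f : subD Y -> X2} {V1 : linFamily X1} {V2 : linFamily X2}.
Variable ft : fibrewiseLift f V1 V2.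

Definition lift_map (v : subD (over Y V1)) : V2 := val (ft v).

Definition glueT : diffeoSpace R := glueD lift_map.

Definition sum_proj (s : V1 + V2) : X1 + X2 :=
  match s with inl v => inl (proj v) | inr v => inr (proj v) end.

Definition sum_fib (s : X1 + X2) : lmodType R :=
  match s with inl x => fib V1 x | inr x => fib V2 x end.

Definition sum_vec (s : X1 + X2) : sum_fib s -> V1 + V2 :=
  match s with
  | inl x => fun a : fib V1 x => inl (vec a)
  | inr x => fun a : fib V2 x => inr (vec a)
  end.

Definition sum_coord (s : X1 + X2) (t : V1 + V2) : sum_fib s :=
  match s, t with
  | inl x, inl v => coord x v
  | inr x, inr v => coord x v
  | _, _ => 0
  end.

Definition glue_proj (q : glueT) : glueD f :=
  class (glue_rel f) (sum_proj (glue_rep q)).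

Definition glue_fib (q : glueD f) : lmodType R := sum_fib (glue_rep q).

Definition glue_vec (q : glueD f) (a : glue_fib q) : glueT :=
  class (glue_rel lift_map) (sum_vec a).

Definition glue_coord (q : glueD f) (v : glueT) : glue_fib q :=
  sum_coord (glue_rep q) (glue_rep v).

Lemma sum_proj_nf s :
  glue_nf f (sum_proj (glue_nf lift_map s)) = glue_nf f (sum_proj s).
Proof.
case: s => // v; have [Yv|Yv] := pselect (over Y V1 v); last by rewrite glue_nf_notin.
pose w : subD (over Y V1) := SigSub (mem_set Yv).
rewrite (_ : v = val w) // glue_nf_in [LHS]/= /lift_map lfun_proj.
by rewrite -(glue_nf_in f (over_base w)).
Qed.

Lemma glue_projE s :
  glue_proj (class (glue_rel lift_map) s) = class (glue_rel f) (sum_proj s).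
Proof.
by rewrite /glue_proj glue_rep_class -class_glue_nf sum_proj_nf class_glue_nf.
Qed.

Lemma sum_proj_normal s : glue_nf lift_map s = s ->
  glue_nf f (sum_proj s) = sum_proj s.
Proof.
case: s => // v; have [Yv|Yv] := pselect (over Y V1 v); last first.
  by move=> _; rewrite glue_nf_notin.
pose w : subD (over Y V1) := SigSub (mem_set Yv).
by rewrite (_ : v = val w) // glue_nf_in.
Qed.

Lemma sum_vec_normal s (a : sum_fib s) : glue_nf f s = s ->
  glue_nf lift_map (sum_vec a) = sum_vec a.
Proof.
case: s a => // x a; have [Yx|Yx] := pselect (Y x); last first.
  by move=> _; apply: glue_nf_notin; rewrite /over /= proj_vec.
pose y : subD Y := SigSub (mem_set Yx).
by rewrite -[x]/(val y) glue_nf_in.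
Qed.

Lemma sum_proj_vec s (a : sum_fib s) : sum_proj (sum_vec a) = s.
Proof. by case: s a => x a /=; rewrite proj_vec. Qed.

Lemma sum_vecK s : cancel (@sum_vec s) (sum_coord s).
Proof. by case: s => x a /=; rewrite vecK. Qed.

Lemma sum_coordK t : sum_vec (sum_coord (sum_proj t) t) = t.
Proof. by case: t => v /=; rewrite coordK. Qed.

Lemma glue_rep_proj q : glue_rep (glue_proj q) = sum_proj (glue_rep q).
Proof.
by rewrite glue_rep_class; apply: sum_proj_normal; exact: glue_nf_rep.
Qed.

Fact glue_proj_vec q a : glue_proj (@glue_vec q a) = q.
Proof. by rewrite glue_projE sum_proj_vec class_glue_rep. Qed.

Fact glue_vecK q : cancel (@glue_vec q) (glue_coord q).
Proof.
move=> a; rewrite /glue_coord glue_rep_class sum_vec_normal ?glue_nf_rep //.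
exact: sum_vecK.
Qed.

Fact glue_coordK v : glue_vec (glue_coord (glue_proj v) v) = v.
Proof.
by rewrite /glue_vec /glue_coord /glue_fib glue_rep_proj sum_coordK class_glue_rep.
Qed.

(* The fibres over X1 \ Y carry the structure of V1, all others that of V2. *)
Definition glue_family : linFamily (glueD f) :=
  LinFamily glue_proj_vec glue_vecK glue_coordK.

Definition inlT (v : V1) : glue_family := inlG lift_map v.
Definition inrT (v : V2) : glue_family := inrG lift_map v.

Lemma inlT_lift (v : subD (over Y V1)) : inlT (val v) = inrT (lift_map v).
Proof. exact: inlG_glue. Qed.

Lemma proj_inlT v : proj (inlT v) = inlG f (proj v).
Proof. exact: glue_projE. Qed.

Lemma proj_inrT v : proj (inrT v) = inrG f (proj v).
Proof. exact: glue_projE. Qed.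

Lemma fadd_glueE (v w : glue_family) : fadd v w =
  class (glue_rel lift_map) (sum_vec (sum_coord (sum_proj (glue_rep v)) (glue_rep v)
    + sum_coord (sum_proj (glue_rep v)) (glue_rep w))).
Proof.
by rewrite /fadd /= /glue_vec /glue_coord /glue_fib glue_rep_proj.
Qed.

Lemma fscale_glueE (c : R) (v : glue_family) : fscale c v =
  class (glue_rel lift_map)
    (sum_vec (c *: sum_coord (sum_proj (glue_rep v)) (glue_rep v))).
Proof.
by rewrite /fscale /= /glue_vec /glue_coord /glue_fib glue_rep_proj.
Qed.

Lemma fadd_inrT v w : fadd (inrT v) (inrT w) = inrT (fadd v w).
Proof. by rewrite fadd_glueE !glue_rep_class. Qed.

Lemma fscale_inrT c v : fscale c (inrT v) = inrT (fscale c v).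
Proof. by rewrite fscale_glueE !glue_rep_class. Qed.

Lemma fzero_inrG x : fzero glue_family (inrG f x) = inrT (fzero V2 x).
Proof. by rewrite /fzero /= /glue_vec /glue_fib glue_rep_class. Qed.

Lemma over_vec_coord (y : subD Y) (v : subD (over Y V1)) :
  proj (val v) = val y -> v = over_vec (coord (val y) (val v)).
Proof. by move=> vy; apply: val_inj => /=; rewrite -vy coordK. Qed.

Lemma lift_coordK (y : subD Y) (v : subD (over Y V1)) :
  proj (val v) = val y -> vec (coord (f y) (lift_map v)) = lift_map v.
Proof.
move=> vy; suff <- : proj (lift_map v) = f y by rewrite coordK.
by rewrite /lift_map lfun_proj; congr f; apply: val_inj.
Qed.

Lemma proj_lift (y : subD Y) (v : subD (over Y V1)) :
  proj (val v) = val y -> proj (lift_map v) = f y.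
Proof.
by move=> vy; rewrite /lift_map lfun_proj; congr f; apply: val_inj.
Qed.

Lemma lift_fadd (u v w : subD (over Y V1)) :
  proj (val v) = proj (val w) -> val u = fadd (val v) (val w) ->
  lift_map u = fadd (lift_map v) (lift_map w).
Proof.
move=> vw uE; pose y := over_base v.
have vy : proj (val v) = val y by [].
have wy : proj (val w) = val y by rewrite -vw.
have uy : proj (val u) = val y by rewrite uE /fadd proj_vec.
rewrite -(lift_coordK uy) /fadd (proj_lift vy); congr vec.
rewrite /lift_map [in RHS](over_vec_coord vy) [in RHS](over_vec_coord wy).
rewrite (over_vec_coord uy) -(linear_add (lfun_linear ft y)).
by rewrite uE /fadd vecK.
Qed.

Lemma lift_fscale c (u v : subD (over Y V1)) :
  val u = fscale c (val v) -> lift_map u = fscale c (lift_map v).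
Proof.
move=> uE; pose y := over_base v.
have vy : proj (val v) = val y by [].
have uy : proj (val u) = val y by rewrite uE /fscale proj_vec.
rewrite -(lift_coordK uy) /fscale (proj_lift vy); congr vec.
rewrite /lift_map [in RHS](over_vec_coord vy).
rewrite (over_vec_coord uy) -(linear_scale (lfun_linear ft y)).
by rewrite uE /fscale vecK.
Qed.

Lemma lift_fzero (y : subD Y) (u : subD (over Y V1)) :
  val u = fzero V1 (val y) -> lift_map u = fzero V2 (f y).
Proof.
move=> uE.
have uy : proj (val u) = val y by rewrite uE /fzero proj_vec.
rewrite -(lift_coordK uy) /fzero; congr vec.
rewrite /lift_map (over_vec_coord uy) uE /fzero vecK.
exact: linear_zero (lfun_linear ft y).
Qed.

Lemma glue_rep_inlT v : ~ over Y V1 v -> glue_rep (inlT v) = inl v.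
Proof. by move=> Yv; rewrite glue_rep_class glue_nf_notin. Qed.

Lemma fadd_inlT v w : proj v = proj w ->
  fadd (inlT v) (inlT w) = inlT (fadd v w).
Proof.
move=> vw; have [Yv|Yv] := pselect (over Y V1 v); last first.
  have Yw : ~ over Y V1 w by rewrite /over /= -vw.
  by rewrite fadd_glueE !glue_rep_inlT.
have Yw : over Y V1 w by rewrite /over /= -vw.
have Yu : over Y V1 (fadd v w) by rewrite /over /= /fadd proj_vec.
pose v' : subD (over Y V1) := SigSub (mem_set Yv).
pose w' : subD (over Y V1) := SigSub (mem_set Yw).
pose u' : subD (over Y V1) := SigSub (mem_set Yu).
rewrite -[fadd v w]/(val u') -[v in LHS]/(val v') -[w in LHS]/(val w').
by rewrite !inlT_lift fadd_inrT (@lift_fadd u' v' w').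
Qed.

Lemma fscale_inlT c v : fscale c (inlT v) = inlT (fscale c v).
Proof.
have [Yv|Yv] := pselect (over Y V1 v); last by rewrite fscale_glueE !glue_rep_inlT.
have Yu : over Y V1 (fscale c v) by rewrite /over /= /fscale proj_vec.
pose v' : subD (over Y V1) := SigSub (mem_set Yv).
pose u' : subD (over Y V1) := SigSub (mem_set Yu).
rewrite -[fscale c v]/(val u') -[v in LHS]/(val v').
by rewrite !inlT_lift fscale_inrT (@lift_fscale c u' v').
Qed.

Lemma fzero_inlG x : fzero glue_family (inlG f x) = inlT (fzero V1 x).
Proof.
have [Yx|Yx] := pselect (Y x); last first.
  by rewrite /fzero /= /glue_vec /glue_fib glue_rep_class glue_nf_notin.
pose y : subD Y := SigSub (mem_set Yx).
have Yu : over Y V1 (fzero V1 x) by rewrite /over /= /fzero proj_vec.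
pose u : subD (over Y V1) := SigSub (mem_set Yu).
rewrite -[fzero V1 x]/(val u) -[x in LHS]/(val y) inlT_lift inlG_glue fzero_inrG.
by rewrite (@lift_fzero y u).
Qed.

Lemma lift_map_smooth : smooth lift_map.
Proof. by move=> n U p pp; exact: (lfun_smooth ft pp). Qed.

Lemma lift_near n (U : set 'rV[R]_n) (q : 'rV[R]_n -> V1) x :
  plot U q -> U x -> (forall y, U y -> over Y V1 (q y)) ->
  exists2 q' : 'rV[R]_n -> V2, plot U q' &
    forall y, U y -> inlT (q y) = inrT (q' y).
Proof.
move=> pq Ux qY; have [p pp pE] := plot_subE pq Ux qY.
exists (lift_map \o p); first exact: lift_map_smooth.
by move=> y /pE <-; exact: inlT_lift.
Qed.

End GlueFamily.

Section GlueBundle.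
Context {R : realType} {X1 X2 : diffeoSpace R} {Y : set X1}.
Context {f : subD Y -> X2} {V1 : pseudoBundle X1} {V2 : pseudoBundle X2}.
Hypothesis f_inj : injective f.
Variable ft : fibrewiseLift f V1 V2.
Let W := glue_family ft.

Fact glue_proj_smooth : smooth (@proj R _ W).
Proof.
apply: glue_smooth => n U p pp.
  apply: (plot_ext (inlG_smooth f (proj_smooth pp))) => x Ux.
  exact: proj_inlT.
apply: (plot_ext (inrG_smooth f (proj_smooth pp))) => x Ux.
exact: proj_inrT.
Qed.

Fact glue_fzero_smooth : smooth (fzero W).
Proof.
apply: glue_smooth => n U p pp.
  apply: (plot_ext (inlG_smooth (lift_map ft) (fzero_smooth V1 pp))) => x Ux.
  exact: fzero_inlG.
apply: (plot_ext (inrG_smooth (lift_map ft) (fzero_smooth V2 pp))) => x Ux.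
exact: fzero_inrG.
Qed.

Fact glue_fscale_smooth : smooth (fun p : prodD (realD R) W => fscale p.1 p.2).
Proof.
move=> n U p [p1 p2]; apply: plot_local => [|x Ux]; first exact: plot_open p1.
have [|] := glue_plotP p2 Ux => -[U' [q [U'x U'U pq pE]]].
  exists U', (fun y => inlT ft (fscale (p y).1 (q y))); split=> //.
    apply: (inlG_smooth (lift_map ft)).
    apply: (@fscale_smooth _ _ V1 n U' (fun y => ((p y).1, q y))).
    by split=> //; exact: plot_sub (plot_open pq) U'U p1.
  by move=> y U'y; rewrite -fscale_inlT -[inlT ft _](pE y U'y).
exists U', (fun y => inrT ft (fscale (p y).1 (q y))); split=> //.
  apply: (inrG_smooth (lift_map ft)).
  apply: (@fscale_smooth _ _ V2 n U' (fun y => ((p y).1, q y))).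
  by split=> //; exact: plot_sub (plot_open pq) U'U p1.
by move=> y U'y; rewrite -fscale_inrT -[inrT ft _](pE y U'y).
Qed.

Lemma glue_fadd_inr n (U : set 'rV[R]_n) (p : 'rV[R]_n -> subD (fprod W W))
    (U' : set 'rV[R]_n) (q1 q2 : 'rV[R]_n -> V2) x :
  U' x -> U' `<=` U -> plot U' q1 -> plot U' q2 ->
  (forall y, U' y -> (val (p y)).1 = inrT ft (q1 y)) ->
  (forall y, U' y -> (val (p y)).2 = inrT ft (q2 y)) ->
  lifts_near (@plot R W n) id U (fun y => fadd (val (p y)).1 (val (p y)).2) x.
Proof.
move=> U'x U'U pq1 pq2 pE1 pE2.
exists U', (fun y => inrT ft (fadd (q1 y) (q2 y))); split=> //; last first.
  by move=> y U'y; rewrite -fadd_inrT pE1 ?pE2.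
apply: (inrG_smooth (lift_map ft)); apply: fadd_plot => // y U'y.
have : proj (val (p y)).1 = proj (val (p y)).2 by exact: set_valP (p y).
rewrite pE1 // pE2 // !proj_inrT; exact: inrG_inj.
Qed.

Fact glue_fadd_smooth :
  smooth (fun p : subD (fprod W W) => fadd (val p).1 (val p).2).
Proof.
move=> n U p [p1 p2]; apply: plot_local => [|x Ux]; first exact: plot_open p1.
have pp y : proj (val (p y)).1 = proj (val (p y)).2 by exact: set_valP (p y).
case: (glue_plotP p1 Ux) => -[U1 [q1 [U1x U1U pq1 pE1]]];
case: (glue_plotP p2 Ux) => -[U2 [q2 [U2x U2U pq2 pE2]]];
have oU12 := openI (plot_open pq1) (plot_open pq2);
have Ux12 : (U1 `&` U2) x by [];
have {}pq1 := plot_sub oU12 (@subIsetl _ U1 U2) pq1;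
have {}pq2 := plot_sub oU12 (@subIsetr _ U1 U2) pq2;
have sU : U1 `&` U2 `<=` U by move=> y [/U1U].
- exists (U1 `&` U2), (fun y => inlT ft (fadd (q1 y) (q2 y))).
  have qE y : (U1 `&` U2) y -> proj (q1 y) = proj (q2 y).
    move=> [U1y U2y]; apply: (inlG_inj f_inj); rewrite -!(proj_inlT ft).
    by rewrite /inlT -(pE1 _ U1y) -(pE2 _ U2y); exact: pp.
  split=> //.
    by apply: (inlG_smooth (lift_map ft)); apply: fadd_plot.
  move=> y [U1y U2y]; rewrite -fadd_inlT; last exact: qE.
  by rewrite /inlT -(pE1 _ U1y) -(pE2 _ U2y).
- have q1Y y : (U1 `&` U2) y -> over Y V1 (q1 y).
    move=> [U1y U2y]; have := pp y.
    rewrite [(val (p y)).1](pE1 _ U1y) [(val (p y)).2](pE2 _ U2y).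
    rewrite [LHS]proj_inlT [RHS]proj_inrT => /inlG_inrG[z zE _].
    by rewrite /over /= zE; exact: set_valP.
  have [q1' pq1' q1E] := lift_near ft pq1 Ux12 q1Y.
  apply: (glue_fadd_inr Ux12 sU pq1' pq2) => y U12y.
    by rewrite -q1E //; apply: pE1; case: U12y.
  by apply: pE2; case: U12y.
- have q2Y y : (U1 `&` U2) y -> over Y V1 (q2 y).
    move=> [U1y U2y]; have := pp y.
    rewrite [(val (p y)).1](pE1 _ U1y) [(val (p y)).2](pE2 _ U2y).
    rewrite [LHS]proj_inrT [RHS]proj_inlT => /esym/inlG_inrG[z zE _].
    by rewrite /over /= zE; exact: set_valP.
  have [q2' pq2' q2E] := lift_near ft pq2 Ux12 q2Y.
  apply: (glue_fadd_inr Ux12 sU pq1 pq2') => y U12y.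
    by apply: pE1; case: U12y.
  by rewrite -q2E //; apply: pE2; case: U12y.
- by apply: (glue_fadd_inr Ux12 sU pq1 pq2) => y [U1y U2y]; [exact: pE1|exact: pE2].
Qed.

(* Injectivity of f makes inlG injective, so that two plots of V1 which are
   fibrewise compatible after gluing are so before; otherwise the fibrewise
   addition of the glued family need not be smooth. *)
Definition glue_bundle : pseudoBundle (glueD f) :=
  PseudoBundle glue_proj_smooth glue_fadd_smooth glue_fscale_smooth
    glue_fzero_smooth.
End GlueBundle.

Section ProductLift.
Context {R : realType} {X1 X2 : diffeoSpace R} {Y : set X1} {f : subD Y -> X2}.
Context {V1 V1' : linFamily X1} {V2 V2' : linFamily X2}.
Variables (ft : fibrewiseLift f V1 V2) (ft' : fibrewiseLift f V1' V2').
Let P1 := prod_family V1 V1'.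
Let P2 := prod_family V2 V2'.

Fact over_fst_subproof (p : subD (over Y P1)) : over Y V1 (val (val p)).1.
Proof. exact: (set_valP p). Qed.

Fact over_snd_subproof (p : subD (over Y P1)) : over Y V1' (val (val p)).2.
Proof.
rewrite /over /=; have /= <- := set_valP (val p); exact: (set_valP p).
Qed.

Definition over_fst (p : subD (over Y P1)) : subD (over Y V1) :=
  SigSub (mem_set (over_fst_subproof p)).

Definition over_snd (p : subD (over Y P1)) : subD (over Y V1') :=
  SigSub (mem_set (over_snd_subproof p)).

Fact prod_lift_fprod (p : subD (over Y P1)) :
  fprod V2 V2' (val (ft (over_fst p)), val (ft' (over_snd p))).
Proof.
rewrite /fprod /= !lfun_proj; congr f; apply: val_inj => /=.
exact: (set_valP (val p)).
Qed.

Fact prod_lift_range (p : subD (over Y P1)) :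
  (@proj R X2 P2 @^-1` range f) (SigSub (mem_set (prod_lift_fprod p))).
Proof. exact: (set_valP (ft (over_fst p))). Qed.

Definition prod_lift_fun (p : subD (over Y P1)) :
  subD (@proj R X2 P2 @^-1` range f) := SigSub (mem_set (prod_lift_range p)).

Fact prod_lift_smooth : smooth prod_lift_fun.
Proof.
move=> n U p [p1 p2]; split.
  exact: (@lfun_smooth _ _ _ _ _ _ _ ft n U (over_fst \o p) p1).
exact: (@lfun_smooth _ _ _ _ _ _ _ ft' n U (over_snd \o p) p2).
Qed.

Fact prod_lift_proj p : proj (val (prod_lift_fun p)) = f (over_base p).
Proof.
by rewrite /= /prod_proj /= lfun_proj; congr f; apply: val_inj.
Qed.

Fact prod_lift_linear (y : subD Y) : linear (fun a : fib P1 (val y) =>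
  coord (f y) (val (prod_lift_fun (over_vec a))) : fib P2 (f y)).
Proof.
have E a : over_fst (over_vec a) = over_vec a.1 by exact: val_inj.
have E' a : over_snd (over_vec a) = over_vec a.2 by exact: val_inj.
move=> c a b /=; rewrite /prod_coord /= !E !E'.
by rewrite !(lfun_linear ft y) !(lfun_linear ft' y).
Qed.

Definition prod_lift : fibrewiseLift f P1 P2 :=
  FibrewiseLift prod_lift_smooth prod_lift_proj prod_lift_linear.
End ProductLift.

(* Main.v *)
Require Import Defs.
From mathcomp Require Import all_boot all_order all_algebra.
From mathcomp Require Import boolp classical_sets reals.
From mathcomp Require Import topology normedtype.
Set Implicit Arguments.
Unset Strict Implicit.
Unset Printing Implicit Defensive.

(** A point of the glued bundle of products is the class of a pair lying in
    one summand, and sending it to the pair of classes gives a map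
    [glue_pair] to the product of the glued bundles.  Working with the normal
    forms in (X1 \ Y) + X2 and its analogue for total spaces, the two component
    projections [sum_fst] and [sum_snd] preserve normal forms and jointly
    determine them, so [glue_pair] is injective even though the lifts need not
    be; it covers the identity of the glued base, and in the coordinates of the
    fibres it is the identity.

    The diffeological content is that [glue_pair] is a subduction
    ([glue_pair_lifts]).  A plot of the product of the glued bundles is a pair
    of plots over the same base point, each of which lifts locally to V1 or V2
    (resp. V1' or V2').  If both lift to the left-hand summands, the lifts lie
    over the same point of X1 because f is injective.  Otherwise one component
    lifts to the right, so that the other one also lies over the image of X2;
    pushing it forward along the lift of f moves it to the right as well
    ([lifts_near_inrT]).  In both cases the two lifts form a plot of a
    product pseudo-bundle.  An injective smooth subduction is a diffeomorphism
    ([subduction_inverse]), and its inverse is the required map. *)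

Import numFieldNormedType.Exports.
Local Open Scope classical_set_scope.
Local Open Scope ring_scope.

(** * Subductions and plots of glued families *)

(** Surjectivity is part of the lifting hypothesis, applied to constant plots;
    the inverse of an injective map is smooth because it sends a plot to its
    local lifts. *)
Lemma subduction_inverse (R : realType) (X Z : diffeoSpace R) (g : X -> Z) :
  smooth g -> injective g ->
  (forall n (U : set 'rV[R]_n) (p : 'rV[R]_n -> Z) x,
    plot U p -> U x -> lifts_near (@plot R X n) g U p x) ->
  exists h : Z -> X, [/\ cancel g h, cancel h g & diffeomorphism h].
Proof.
move=> g_smooth g_inj g_lift.
have g_surj z : exists x, g x = z.
  have pz := @plot_cst R Z 0%N setT z openT.
  have [W [q [W0 _ _ qE]]] := g_lift _ _ _ 0 pz I.
  by exists (q 0); rewrite -qE.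
have [h hK] := choice g_surj.
have gK : cancel g h by move=> x; apply: g_inj.
exists h; split=> //; split; last by exists g.
move=> n U p pp; apply: plot_local => [|x Ux]; first exact: plot_open pp.
have [W [q [Wx WU pq qE]]] := g_lift _ _ _ _ pp Ux.
by exists W, q; split=> // y /qE /= ->; rewrite gK.
Qed.

(** Locally [p] comes from V1 or from V2.  In the first case its lift to V1 lies
    over Y, because a point of X1 is identified with a point of X2 only when it
    is in Y; pushing that lift forward along [ft] yields one to V2. *)
Lemma lifts_near_inrT (R : realType) (X1 X2 : diffeoSpace R) (Y : set X1)
    (f : subD Y -> X2) (V1 : linFamily X1) (V2 : linFamily X2)
    (ft : fibrewiseLift f V1 V2) n (U : set 'rV[R]_n)
    (p : 'rV[R]_n -> glue_family ft) x :
  plot U p -> U x -> (forall y, U y -> exists z, proj (p y) = inrG f z) ->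
  lifts_near (@plot R V2 n) (inrT ft) U p x.
Proof.
move=> pp Ux pR; have [|//] := glue_plotP pp Ux.
move=> [W [q [Wx WU pq pE]]].
have qY y : W y -> Defs.over Y V1 (q y).
  move=> Wy; have [z] := pR y (WU y Wy).
  rewrite [p y](pE y Wy) [LHS]proj_inlT => /inlG_inrG[t tE _].
  by rewrite /Defs.over /= tE; exact: set_valP.
have [q' pq' qE] := lift_near ft pq Wx qY.
by exists W, q'; split=> // y Wy; rewrite -qE //; exact: pE.
Qed.

(** * Comparison of the glued product with the product of the glued bundles *)

Section GlueProduct.
Context {R : realType} {X1 X2 : diffeoSpace R} {Y : set X1} {f : subD Y -> X2}.
Context {V1 V1' : pseudoBundle X1} {V2 V2' : pseudoBundle X2}.
Variables (ft : fibrewiseLift f V1 V2) (ft' : fibrewiseLift f V1' V2').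
Let P1 := prod_bundle V1 V1'.
Let P2 := prod_bundle V2 V2'.
Let B : linFamily (glueD f) := @glue_family R X1 X2 Y f P1 P2 (prod_lift ft ft').
Let W := glue_family ft.
Let W' := glue_family ft'.
Let f_prod := @lift_map R X1 X2 Y f P1 P2 (prod_lift ft ft').

Definition sum_fst (s : P1 + P2) : V1 + V2 :=
  match s with inl p => inl (val p).1 | inr p => inr (val p).1 end.

Definition sum_snd (s : P1 + P2) : V1' + V2' :=
  match s with inl p => inl (val p).2 | inr p => inr (val p).2 end.

Lemma sum_proj_fst s : sum_proj (sum_fst s) = sum_proj s.
Proof. by case: s. Qed.

Lemma sum_proj_snd s : sum_proj (sum_snd s) = sum_proj s.
Proof. by case: s => p /=; have /= <- := set_valP p. Qed.

Lemma sum_fst_snd_inj s t : sum_fst s = sum_fst t -> sum_snd s = sum_snd t ->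
  s = t.
Proof.
case: s t => [[[a b] ?]|[[a b] ?]] [[[a' b'] ?]|[[a' b'] ?]] //= [ea] [eb];
  by congr (_ _); apply: val_inj; rewrite /= ea eb.
Qed.

Lemma over_of_snd (p : P1) : Defs.over Y V1' (val p).2 -> Defs.over Y P1 p.
Proof. by rewrite /Defs.over /= /prod_proj; have /= -> := set_valP p. Qed.

Lemma normal_notin (p : P1) : glue_nf f_prod (inl p) = inl p -> ~ Defs.over Y P1 p.
Proof.
move=> pn Yp; pose w : subD (Defs.over Y P1) := SigSub (mem_set Yp).
by move: pn; rewrite -[p]/(val w) glue_nf_in.
Qed.

Lemma sum_fst_normal s : glue_nf f_prod s = s ->
  glue_nf (lift_map ft) (sum_fst s) = sum_fst s.
Proof. by case: s => // p /normal_notin pY; rewrite glue_nf_notin. Qed.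

Lemma sum_snd_normal s : glue_nf f_prod s = s ->
  glue_nf (lift_map ft') (sum_snd s) = sum_snd s.
Proof.
case: s => // p /normal_notin pY; rewrite glue_nf_notin //.
by move/over_of_snd.
Qed.

Lemma class_sum_fst_nf s : class (glue_rel (lift_map ft)) (sum_fst (glue_nf f_prod s)) =
  class (glue_rel (lift_map ft)) (sum_fst s).
Proof.
case: s => // p; have [Yp|Yp] := pselect (Defs.over Y P1 p); last by rewrite glue_nf_notin.
pose w : subD (Defs.over Y P1) := SigSub (mem_set Yp).
rewrite -[p]/(val w) glue_nf_in; exact/esym/(inlT_lift ft (over_fst w)).
Qed.

Lemma class_sum_snd_nf s : class (glue_rel (lift_map ft')) (sum_snd (glue_nf f_prod s)) =
  class (glue_rel (lift_map ft')) (sum_snd s).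
Proof.
case: s => // p; have [Yp|Yp] := pselect (Defs.over Y P1 p); last by rewrite glue_nf_notin.
pose w : subD (Defs.over Y P1) := SigSub (mem_set Yp).
rewrite -[p]/(val w) glue_nf_in; exact/esym/(inlT_lift ft' (over_snd w)).
Qed.

Definition glue_fst (u : B) : W := class (glue_rel (lift_map ft)) (sum_fst (glue_rep u)).

Definition glue_snd (u : B) : W' :=
  class (glue_rel (lift_map ft')) (sum_snd (glue_rep u)).

Lemma proj_glue_fst u : proj (glue_fst u) = proj u.
Proof. by rewrite [LHS]glue_projE sum_proj_fst. Qed.

Lemma proj_glue_snd u : proj (glue_snd u) = proj u.
Proof. by rewrite [LHS]glue_projE sum_proj_snd. Qed.

Fact glue_pair_subproof u : Defs.fprod W W' (glue_fst u, glue_snd u).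
Proof. exact: etrans (proj_glue_fst u) (esym (proj_glue_snd u)). Qed.

Definition glue_pair (u : B) : prod_family W W' :=
  SigSub (mem_set (glue_pair_subproof u)).

Lemma glue_pair_class s : val (glue_pair (class (glue_rel f_prod) s)) =
  (class (glue_rel (lift_map ft)) (sum_fst s),
   class (glue_rel (lift_map ft')) (sum_snd s)).
Proof.
by rewrite /= /glue_fst /glue_snd !glue_rep_class class_sum_fst_nf class_sum_snd_nf.
Qed.

(** The lifts may identify points of V1 over Y, so injectivity is read off
    normal forms, which are separated by their two components. *)
Lemma glue_pair_inj : injective glue_pair.
Proof.
move=> u u' uu'.
have e : glue_fst u = glue_fst u' := congr1 (fun v => (val v).1) uu'.
have e' : glue_snd u = glue_snd u' := congr1 (fun v => (val v).2) uu'.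
have un := glue_nf_rep u; have un' := glue_nf_rep u'.
rewrite -[u]class_glue_rep -[u']class_glue_rep; congr class.
apply: sum_fst_snd_inj.
  by move/(congr1 (@glue_rep _ _ _ _ _)): e; rewrite !glue_rep_class !sum_fst_normal.
by move/(congr1 (@glue_rep _ _ _ _ _)): e'; rewrite !glue_rep_class !sum_snd_normal.
Qed.

Lemma glue_pair_smooth : smooth glue_pair.
Proof.
apply: glue_smooth => n U p [p1 p2]; split.
- apply: (plot_ext (inlG_smooth (lift_map ft) p1)) => x _.
  exact: (congr1 fst (glue_pair_class (inl (p x)))).
- apply: (plot_ext (inlG_smooth (lift_map ft') p2)) => x _.
  exact: (congr1 snd (glue_pair_class (inl (p x)))).
- apply: (plot_ext (inrG_smooth (lift_map ft) p1)) => x _.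
  exact: (congr1 fst (glue_pair_class (inr (p x)))).
- apply: (plot_ext (inrG_smooth (lift_map ft') p2)) => x _.
  exact: (congr1 snd (glue_pair_class (inr (p x)))).
Qed.

(** * Local lifts of plots *)

(** The common base point of the two lifts is well defined because X2 embeds
    in the gluing. *)
Lemma glue_pair_lifts_inr n (U U1 U2 : set 'rV[R]_n)
    (p : 'rV[R]_n -> prod_family W W') (q1 : 'rV[R]_n -> V2)
    (q2 : 'rV[R]_n -> V2') x :
  U1 x -> U2 x -> U1 `<=` U -> plot U1 q1 -> plot U2 q2 ->
  (forall y, U1 y -> (val (p y)).1 = inrT ft (q1 y)) ->
  (forall y, U2 y -> (val (p y)).2 = inrT ft' (q2 y)) ->
  lifts_near (@plot R B n) glue_pair U p x.
Proof.
move=> U1x U2x U1U pq1 pq2 pE1 pE2.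
have oU12 := openI (plot_open pq1) (plot_open pq2).
have Ux12 : (U1 `&` U2) x by [].
have {}pq1 := plot_sub oU12 (@subIsetl _ U1 U2) pq1.
have {}pq2 := plot_sub oU12 (@subIsetr _ U1 U2) pq2.
pose r y : prodD V2 V2' := (q1 y, q2 y).
have pr : plot (U1 `&` U2) r by split.
have rP y : (U1 `&` U2) y -> Defs.fprod V2 V2' (r y).
  move=> [U1y U2y]; have : proj (val (p y)).1 = proj (val (p y)).2.
    exact: set_valP (p y).
  by rewrite pE1 // pE2 // !proj_inrT; exact: inrG_inj.
have [q pq qE] := plot_subE pr Ux12 rP.
exists (U1 `&` U2), (inrG f_prod \o q); split=> //; first by move=> y [/U1U].
  exact: inrG_smooth.
move=> y U12y; have [U1y U2y] := U12y; apply: val_inj.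
rewrite glue_pair_class /= qE // [LHS]surjective_pairing.
by congr pair; [exact: pE1|exact: pE2].
Qed.

Hypothesis f_inj : injective f.

(** Here injectivity of [f] is essential: without it two plots that agree in the
    glued base may lie over different points of Y. *)
Lemma glue_pair_lifts_inl n (U U1 U2 : set 'rV[R]_n)
    (p : 'rV[R]_n -> prod_family W W') (q1 : 'rV[R]_n -> V1)
    (q2 : 'rV[R]_n -> V1') x :
  U1 x -> U2 x -> U1 `<=` U -> plot U1 q1 -> plot U2 q2 ->
  (forall y, U1 y -> (val (p y)).1 = inlT ft (q1 y)) ->
  (forall y, U2 y -> (val (p y)).2 = inlT ft' (q2 y)) ->
  lifts_near (@plot R B n) glue_pair U p x.
Proof.
move=> U1x U2x U1U pq1 pq2 pE1 pE2.
have oU12 := openI (plot_open pq1) (plot_open pq2).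
have Ux12 : (U1 `&` U2) x by [].
have {}pq1 := plot_sub oU12 (@subIsetl _ U1 U2) pq1.
have {}pq2 := plot_sub oU12 (@subIsetr _ U1 U2) pq2.
pose r y : prodD V1 V1' := (q1 y, q2 y).
have pr : plot (U1 `&` U2) r by split.
have rP y : (U1 `&` U2) y -> Defs.fprod V1 V1' (r y).
  move=> [U1y U2y]; have : proj (val (p y)).1 = proj (val (p y)).2.
    exact: set_valP (p y).
  by rewrite pE1 // pE2 // !proj_inlT; exact: inlG_inj.
have [q pq qE] := plot_subE pr Ux12 rP.
exists (U1 `&` U2), (inlG f_prod \o q); split=> //; first by move=> y [/U1U].
  exact: inlG_smooth.
move=> y U12y; have [U1y U2y] := U12y; apply: val_inj.
rewrite glue_pair_class /= qE // [LHS]surjective_pairing.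
by congr pair; [exact: pE1|exact: pE2].
Qed.

Lemma glue_pair_lifts n (U : set 'rV[R]_n) (p : 'rV[R]_n -> prod_family W W') x :
  plot U p -> U x -> lifts_near (@plot R B n) glue_pair U p x.
Proof.
move=> [p1 p2] Ux.
have pp y : proj (val (p y)).1 = proj (val (p y)).2 by exact: set_valP (p y).
case: (glue_plotP p1 Ux) => -[U1 [q1 [U1x U1U pq1 pE1]]]; last first.
  have pR y : U1 y -> exists z, proj (val (p y)).2 = inrG f z.
    move=> U1y; exists (proj (q1 y)).
    by rewrite -pp [(val (p y)).1](pE1 _ U1y) [LHS]proj_inrT.
  have p2' := plot_sub (plot_open pq1) U1U p2.
  have [U2 [q2 [U2x U2U pq2 pE2]]] := lifts_near_inrT p2' U1x pR.
  exact: (glue_pair_lifts_inr U1x U2x U1U pq1 pq2 pE1 pE2).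
case: (glue_plotP p2 Ux) => -[U2 [q2 [U2x U2U pq2 pE2]]].
  exact: (glue_pair_lifts_inl U1x U2x U1U pq1 pq2 pE1 pE2).
have pR y : U2 y -> exists z, proj (val (p y)).1 = inrG f z.
  move=> U2y; exists (proj (q2 y)).
  by rewrite pp [(val (p y)).2](pE2 _ U2y) [LHS]proj_inrT.
have p1' := plot_sub (plot_open pq2) U2U p1.
have [U3 [q3 [U3x U3U pq3 pE3]]] := lifts_near_inrT p1' U2x pR.
exact: (glue_pair_lifts_inr U3x U2x (subset_trans U3U U2U) pq3 pq2 pE3 pE2).
Qed.

(** * The comparison map on fibres *)

(** Over a base point with normal form in X1 (resp. X2), both fibres are the
    product of the fibres of V1 and V1' (resp. V2 and V2'), and any left inverse
    of [glue_pair] is the identity in these coordinates. *)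
Lemma glue_pair_inv_linear (h : prod_family W W' -> B) : cancel glue_pair h ->
  forall x, linear (fun a : fib (prod_family W W') x => Defs.coord x (h (vec a))).
Proof.
move=> hK x.
(* The fibre types depend on x through its normal form s only; generalizing
   over s makes the case analysis on the summand possible. *)
suff [g gl gE] : exists2 g : fib (prod_family W W') x -> fib B x,
    linear g & forall a, vec a = glue_pair (vec (g a)).
  by move=> c a b; rewrite !gE !hK !vecK gl.
suff H (s : X1 + X2) : exists2 g : (@sum_fib R X1 X2 V1 V2 s *
      @sum_fib R X1 X2 V1' V2' s)%type -> @sum_fib R X1 X2 P1 P2 s,
    linear g & forall a, sum_vec a.1 = sum_fst (sum_vec (g a)) /\
                         sum_vec a.2 = sum_snd (sum_vec (g a)).
  have [g gl gE] := H (glue_rep x); exists g => // a.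
  have [e1 e2] := gE a.
  by apply: val_inj; rewrite [RHS]glue_pair_class /= -e1 -e2.
by case: s => z /=; exists id.
Qed.

End GlueProduct.

Theorem lemma5p15 (R : realType) (X1 X2 : diffeoSpace R)
    (V1 V1' : pseudoBundle X1) (V2 V2' : pseudoBundle X2)
    (Y : set X1) (f : subD Y -> X2)
    (f_smooth : smooth f) (f_inj : injective f)
    (ft : fibrewiseLift f V1 V2) (ft' : fibrewiseLift f V1' V2') :
  bundle_diffeomorphic
    (prod_bundle (glue_bundle f_inj ft) (glue_bundle f_inj ft'))
    (@glue_bundle R X1 X2 Y f (prod_bundle V1 V1') (prod_bundle V2 V2') f_inj
       (prod_lift ft ft')).
Proof.
have [h [gK hK h_diffeo]] := subduction_inverse
  (@glue_pair_smooth _ _ _ _ _ _ _ _ _ ft ft') (@glue_pair_inj _ _ _ _ _ _ _ _ _ ft ft')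
  (@glue_pair_lifts _ _ _ _ _ _ _ _ _ ft ft' f_inj).
exists h, id; split=> //; last exact: glue_pair_inv_linear gK.
- by split=> [n U p //|]; exists id; split=> // n U p.
- by move=> v; rewrite -[v in RHS]hK; exact/esym/proj_glue_fst.
Qed.
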